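(* For every integer $s\ge1$, \[\theta(2s)=(-1)^{s-1}\left(\frac{(2s-1)\pi^{2s}}{4(2s)!}+\sum_{k=1}^{s-1}\frac{(-1)^{s-k}\pi^{2k}}{2(2k)!}\zeta(2s-2k)\right),\] and \[\phi(2s)=(-1)^{s-1}\left(\frac{(2s-1)\pi^{2s}}{4(2s+1)!}+\sum_{k=1}^{s-1}\frac{(-1)^{s-k}\pi^{2k}}{(2k+1)!\,2^{2s-2k}}\zeta(2s-2k)\right).\]
   Context: $\zeta(s)=\sum_{n\ge1}n^{-s}$, $\theta(s)=\sum_{n\ge0}(2n+1)^{-s}=(1-2^{-s})\zeta(s)$, $\phi(s)=\sum_{n\ge1}(2n)^{-s}=2^{-s}\zeta(s)$. Empty sums are zero. *)

(* Defs.v *)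
From Stdlib Require Import Reals.
From Coquelicot Require Import Coquelicot.
Open Scope R_scope.

(* [Series] is total.  The three series below converge exactly when [1 < s];
   outside that range the values carry no meaning.  The argument is real, and
   [Rpower] is applied to positive bases only.  Since [Series] indexes from 0,
   the sums over n >= 1 are shifted by one. *)

Definition zeta (s : R) : R :=
  Series (fun n : nat => Rpower (INR (n + 1)) (- s)).

Definition theta (s : R) : R :=
  Series (fun n : nat => Rpower (INR (2 * n + 1)) (- s)).

Definition phi (s : R) : R :=
  Series (fun n : nat => Rpower (INR (2 * (n + 1))) (- s)).

(* Main.v *)
(* Repeated integration by parts turns the cosine moments
     int_0^L (L - x)^m / m! cos (a x) dx,   a = n + 1,
   into polynomials in 1 / a^2: for L = 2 PI and m = 2s every term is a
   multiple of 1 / a^(2j), and for L = PI and m = 2s - 1 the last term is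
   (1 - cos (a PI)) / a^(2s), which keeps odd a only and so sums to
   2 theta(2s).  Summing over a yields both formulas once the sum of the
   moments is known, that is, the value at 0 of a cosine series.  Writing
   F(x) = F(0) + x h(x), this is the Riemann-Lebesgue lemma applied to
   h(x) x / (2 sin (x/2)), by the closed form of the Dirichlet kernel. *)

Require Import Defs.
From Stdlib Require Import Reals Factorial Lra Lia.
From Coquelicot Require Import Coquelicot.
Open Scope R_scope.

(** * Continuity and integrability of real functions *)

Lemma continuous_Rmult (f g : R -> R) (x : R) :
  continuous f x -> continuous g x -> continuous (fun y => f y * g y) x.
Proof. exact (@continuous_mult R_UniformSpace R_AbsRing f g x). Qed.

Lemma is_derive_continuous (f : R -> R) (x l : R) :
  is_derive f x l -> continuous f x.
Proof. intros H; apply (@ex_derive_continuous R_AbsRing); exists l; exact H. Qed.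

Lemma continuous_cos_lin (a x : R) : continuous (fun y => cos (a * y)) x.
Proof. apply (@ex_derive_continuous R_AbsRing); auto_derive; trivial. Qed.

Lemma ex_RInt_continuous_R (f : R -> R) (a b : R) :
  (forall x, continuous f x) -> ex_RInt f a b.
Proof. intros H; apply (@ex_RInt_continuous R_CompleteNormedModule); auto. Qed.

(** * The power series of sine and the quotient x / (2 sin (x/2)) *)

Lemma CV_radius_sin_n : CV_radius sin_n = p_infty.
Proof.
  apply CV_radius_infinite_DAlembert.
  - intros n; unfold sin_n; apply Rmult_integral_contrapositive_currified.
    + apply pow_nonzero; lra.
    + apply Rinv_neq_0_compat, INR_fact_neq_0.
  - apply is_lim_seq_Reals, Alembert_sin.
Qed.

(** The definition of [sin] is already [x] times a power series in the square of [x]. Naming that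
    series gives sin x / x as a function that is smooth at 0. *)
Lemma sin_PSeries (x : R) : sin x = x * PSeries sin_n (x * x).
Proof.
  unfold sin; destruct (exist_sin (Rsqr x)) as [l Hl].
  f_equal; symmetry; apply is_pseries_unique, is_pseries_R, is_series_Reals.
  exact Hl.
Qed.

(** The function [q] is x / (2 sin (x/2)) with its singularity at 0 removed. With sin y = y r(y^2)
    it becomes 1 / r(x^2/4), which is continuously differentiable wherever [r] does not vanish. *)
Lemma ratio_half_sin :
  exists q q' : R -> R,
    (forall x, 0 <= x <= PI -> is_derive q x (q' x)) /\
    (forall x, 0 <= x <= PI -> continuous q' x) /\
    (forall x, 0 <= x <= PI -> q x * (2 * sin (x / 2)) = x).
Proof.
  set (r := PSeries sin_n); set (r' := PSeries (PS_derive sin_n)).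
  assert (Dr : forall t, is_derive r t (r' t)).
  { intros t; apply is_derive_PSeries; rewrite CV_radius_sin_n; exact I. }
  assert (Cr' : forall t, continuous r' t).
  { intros t; apply (is_derive_continuous _ _ (PSeries (PS_derive (PS_derive sin_n)) t)).
    apply is_derive_PSeries; rewrite CV_radius_derive, CV_radius_sin_n; exact I. }
  assert (Hr : forall x, sin (x / 2) = x / 2 * r (x * x / 4)).
  { intros x; rewrite sin_PSeries; f_equal; unfold r; f_equal; field. }
  (* At 0 the value is the constant coefficient 1; on (0, PI] a zero of [r] would make sin (x/2)
     vanish, whereas it is positive there. *)
  assert (r0 : forall x, 0 <= x <= PI -> r (x * x / 4) <> 0).
  { intros x Hx; destruct (Req_dec x 0) as [->|Hx0].
    - replace (0 * 0 / 4) with 0 by field.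
      unfold r; rewrite PSeries_0; unfold sin_n; simpl; lra.
    - intros E; assert (0 < sin (x / 2)) by (apply sin_gt_0; lra).
      rewrite Hr, E in H; lra. }
  assert (Dq : forall x, is_derive (fun y => r (y * y / 4)) x (x / 2 * r' (x * x / 4))).
  { intros x; apply (is_derive_comp r (fun y => y * y / 4)); [apply Dr|].
    auto_derive; [trivial|field]. }
  exists (fun x => / r (x * x / 4)),
    (fun x => - (x / 2 * r' (x * x / 4)) / (r (x * x / 4)) ^ 2).
  split; [|split].
  - intros x Hx; apply (is_derive_inv (fun y => r (y * y / 4))); auto.
  - intros x Hx; apply continuous_Rmult.
    + apply (@continuous_opp R_UniformSpace R_AbsRing R_NormedModule).
      apply continuous_Rmult.
      * apply (@ex_derive_continuous R_AbsRing); auto_derive; trivial.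
      * apply (continuous_comp (fun y => y * y / 4) r'); [|apply Cr'].
        apply (@ex_derive_continuous R_AbsRing); auto_derive; trivial.
    + apply (is_derive_continuous _ _ (- (2 * (x / 2 * r' (x * x / 4)) * r (x * x / 4)) / ((r (x * x / 4)) ^ 2) ^ 2)).
      apply (is_derive_inv (fun y => (r (y * y / 4)) ^ 2));
        [|apply pow_nonzero; auto].
      generalize (is_derive_pow _ 2 _ _ (Dq x)); simpl; intros H.
      eapply is_derive_ext_loc; [|evar_last; [exact H|]].
      * apply filter_forall; intros t; reflexivity.
      * simpl; ring.
  - intros x Hx; rewrite Hr; field; auto.
Qed.

(** * Riemann-Lebesgue lemma and Dirichlet kernel *)

(** For continuously differentiable [g] a single integration by parts suffices: it bounds the
    integral by M / (N + 3/2), where M is |g(b)| + |g(0)| plus the integral of |g'|. The frequency N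
    + 3/2 is the one produced by the Dirichlet kernel. *)
Lemma riemann_lebesgue_sin (g g' : R -> R) (b : R) :
  0 <= b ->
  (forall x, 0 <= x <= b -> is_derive g x (g' x)) ->
  (forall x, 0 <= x <= b -> continuous g' x) ->
  is_lim_seq (fun N => RInt (fun x => g x * sin ((INR N + 3 / 2) * x)) 0 b) 0.
Proof.
  intros Hb Dg Cg.
  assert (Eg : ex_RInt (fun x => Rabs (g' x)) 0 b).
  { apply (@ex_RInt_continuous R_CompleteNormedModule).
    rewrite Rmin_left, Rmax_right by lra; intros x Hx.
    apply (continuous_comp g' Rabs); [auto|apply continuous_Rabs]. }
  set (M := Rabs (g b) + Rabs (g 0) + RInt (fun x => Rabs (g' x)) 0 b).
  assert (Hlim : is_lim_seq (fun N => M / (INR N + 3 / 2)) 0).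
  { replace (Finite 0) with (Rbar_mult M (Rbar_inv p_infty))
      by (simpl; f_equal; ring).
    apply is_lim_seq_scal_l, is_lim_seq_inv; [|discriminate].
    apply is_lim_seq_plus with p_infty (3 / 2);
      [apply is_lim_seq_INR|apply is_lim_seq_const|reflexivity]. }
  apply is_lim_seq_abs_0.
  apply is_lim_seq_le_le with (fun _ => 0) (fun N => M / (INR N + 3 / 2));
    [|apply is_lim_seq_const|exact Hlim].
  intros N; split; [apply Rabs_pos|].
  set (w := INR N + 3 / 2); assert (Hw : 0 < w) by (generalize (pos_INR N); unfold w; lra).
  assert (Ecos : ex_RInt (fun x => g' x * cos (w * x)) 0 b).
  { apply (@ex_RInt_continuous R_CompleteNormedModule).
    rewrite Rmin_left, Rmax_right by lra; intros x Hx.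
    apply continuous_Rmult; [auto|apply continuous_cos_lin]. }
  set (K := RInt (fun x => g' x * cos (w * x)) 0 b).
  assert (HK : Rabs K <= RInt (fun x => Rabs (g' x)) 0 b).
  { eapply Rle_trans; [apply abs_RInt_le; [lra|exact Ecos]|].
    apply RInt_le; [lra| |exact Eg|].
    - apply ex_RInt_norm; exact Ecos.
    - intros x _; rewrite Rabs_mult; rewrite <- (Rmult_1_r (Rabs (g' x))) at 2.
      apply Rmult_le_compat_l; [apply Rabs_pos|].
      apply Rabs_le, COS_bound. }
  assert (HI : is_RInt (fun x => g x * sin (w * x)) 0 b
     (g b * (- cos (w * b) / w) - g 0 * (- cos (w * 0) / w) - - (K / w))).
  { apply (is_RInt_scal_derive_r (V := R_CompleteNormedModule) g
      (fun x => - cos (w * x) / w) g' (fun x => sin (w * x)) 0 b (- (K / w)));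
      rewrite ?Rmin_left, ?Rmax_right by lra; auto.
    - intros x _; auto_derive; [trivial|field; lra].
    - intros x _; apply (@ex_derive_continuous R_AbsRing); auto_derive; trivial.
    - apply (is_RInt_ext (fun x => scal (- / w) (g' x * cos (w * x)))).
      + intros x _; unfold scal; simpl; unfold mult; simpl; field; lra.
      + replace (- (K / w)) with (scal (- / w) K)
          by (unfold scal; simpl; unfold mult; simpl; field; lra).
        apply (is_RInt_scal (V := R_NormedModule)), (RInt_correct (V := R_CompleteNormedModule)).
        exact Ecos. }
  rewrite (is_RInt_unique _ _ _ _ HI).
  replace (g b * (- cos (w * b) / w) - g 0 * (- cos (w * 0) / w) - - (K / w))
    with ((- (g b * cos (w * b)) + g 0 * cos (w * 0) + K) / w) by (field; lra).
  unfold Rdiv; rewrite Rabs_mult, (Rabs_pos_eq (/ w)) by (left; apply Rinv_0_lt_compat; lra).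
  apply Rmult_le_compat_r; [left; apply Rinv_0_lt_compat; lra|].
  assert (Hc : forall u t, Rabs (u * cos t) <= Rabs u).
  { intros u t; rewrite Rabs_mult; rewrite <- (Rmult_1_r (Rabs u)) at 2.
    apply Rmult_le_compat_l; [apply Rabs_pos|apply Rabs_le, COS_bound]. }
  unfold M.
  generalize (Hc (g b) (w * b)) (Hc (g 0) (w * 0)).
  generalize (Rabs_triang (- (g b * cos (w * b)) + g 0 * cos (w * 0)) K)
    (Rabs_triang (- (g b * cos (w * b))) (g 0 * cos (w * 0))).
  rewrite Rabs_Ropp; lra.
Qed.

(** The product 2 sin (x/2) cos y equals sin (y + x/2) - sin (y - x/2), so the sum telescopes. The
    last frequency is N + 1, because [sum_n] includes index [N]; this is where 3/2 comes from. The
    factor sin (x/2) stays on the left, so nothing is divided by zero. *)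
Lemma dirichlet_kernel (N : nat) (x : R) :
  2 * sin (x / 2) * sum_n (fun n => cos ((INR n + 1) * x)) N =
  sin ((INR N + 3 / 2) * x) - sin (x / 2).
Proof.
  assert (E : forall y, 2 * sin (x / 2) * cos y = sin (y + x / 2) - sin (y - x / 2)).
  { intros y; rewrite sin_plus, sin_minus; ring. }
  induction N as [|N IH].
  - rewrite sum_O, E; simpl; f_equal; f_equal; field.
  - rewrite sum_Sn; unfold plus; simpl plus.
    rewrite Rmult_plus_distr_l, IH, E, S_INR.
    replace ((INR N + 1 + 1) * x - x / 2) with ((INR N + 3 / 2) * x) by field.
    replace ((INR N + 1 + 1) * x + x / 2) with ((INR N + 1 + 3 / 2) * x) by field.
    ring.
Qed.

Lemma sum_n_RInt (f : nat -> R -> R) (a b : R) (N : nat) :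
  (forall n, ex_RInt (f n) a b) ->
  is_RInt (fun x => sum_n (fun n => f n x) N) a b (sum_n (fun n => RInt (f n) a b) N).
Proof.
  intros H; induction N as [|N IH].
  - rewrite sum_O; apply (is_RInt_ext (f 0%nat)).
    + intros x _; rewrite sum_O; reflexivity.
    + apply (RInt_correct (V := R_CompleteNormedModule)), H.
  - rewrite sum_Sn.
    apply (is_RInt_ext (fun x => plus (sum_n (fun n => f n x) N) (f (S N) x))).
    + intros x _; rewrite sum_Sn; reflexivity.
    + apply (is_RInt_plus (V := R_NormedModule)); [exact IH|].
      apply (RInt_correct (V := R_CompleteNormedModule)), H.
Qed.

(** * The value at 0 of a cosine series *)

Lemma sin_INR_PI (n : nat) : sin (INR n * PI) = 0.
Proof.
  induction n as [|n IH]; [simpl; rewrite Rmult_0_l; apply sin_0|].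
  rewrite S_INR, Rmult_plus_distr_r, Rmult_1_l, neg_sin, IH; ring.
Qed.

Lemma is_RInt_cos (a L : R) :
  a <> 0 -> is_RInt (fun x => cos (a * x)) 0 L (sin (a * L) / a).
Proof.
  intros Ha.
  evar_last.
  - apply (is_RInt_derive (V := R_CompleteNormedModule) (fun x => sin (a * x) / a)).
    + intros x _; auto_derive; [trivial|field; exact Ha].
    + intros x _; apply continuous_cos_lin.
  - unfold minus, plus, opp; simpl; rewrite Rmult_0_r, sin_0; field; exact Ha.
Qed.

(** This is the Fourier series at 0 of the even extension of [F] from [0, PI]: F(0) is the mean of
    [F] plus 2 / PI times the sum of these integrals, and the identity is solved for the sum. *)
Lemma cosine_series_at_0 (F h h' : R -> R) :
  (forall x, is_derive h x (h' x)) -> (forall x, continuous h' x) ->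
  (forall x, F x = F 0 + x * h x) ->
  is_series (fun n => RInt (fun x => F x * cos ((INR n + 1) * x)) 0 PI)
    (PI / 2 * F 0 - RInt F 0 PI / 2).
Proof.
  intros Dh Ch HF.
  destruct ratio_half_sin as (q & q' & Dq & Cq & Hq).
  assert (P0 := PI_RGT_0).
  assert (Ch0 : forall x, continuous h x).
  { intros x; exact (is_derive_continuous _ _ _ (Dh x)). }
  assert (Cxh : forall x, continuous (fun y => y * h y) x).
  { intros x; apply continuous_Rmult; [apply continuous_id|apply Ch0]. }
  assert (Ixh : is_RInt (fun x => x * h x) 0 PI (RInt (fun x => x * h x) 0 PI)).
  { apply (RInt_correct (V := R_CompleteNormedModule)), ex_RInt_continuous_R, Cxh. }
  set (X := RInt (fun x => x * h x) 0 PI) in *.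
  assert (IF : RInt F 0 PI = PI * F 0 + X).
  { apply is_RInt_unique, (is_RInt_ext (fun x => plus (F 0) (x * h x))).
    - intros x _; rewrite (HF x) at 1; reflexivity.
    - apply (is_RInt_plus (V := R_NormedModule)); [|exact Ixh].
      replace (PI * F 0) with (scal (PI - 0) (F 0))
        by (unfold scal; simpl; unfold mult; simpl; ring).
      apply (is_RInt_const (V := R_NormedModule)). }
  replace (PI / 2 * F 0 - RInt F 0 PI / 2) with (- X / 2) by (rewrite IF; field).
  assert (Eg : forall n, ex_RInt (fun x => x * h x * cos ((INR n + 1) * x)) 0 PI).
  { intros n; apply ex_RInt_continuous_R; intros x.
    apply continuous_Rmult; [apply Cxh|apply continuous_cos_lin]. }
  (* The constant F(0) drops out of every term, since cos ((n + 1) x) integrates to sin ((n + 1) PI)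
     / (n + 1) = 0. *)
  apply (is_series_ext (fun n => RInt (fun x => x * h x * cos ((INR n + 1) * x)) 0 PI)).
  { intros n; symmetry; apply is_RInt_unique.
    apply (is_RInt_ext (fun x => plus (scal (F 0) (cos ((INR n + 1) * x)))
      (x * h x * cos ((INR n + 1) * x)))).
    - intros x _; rewrite (HF x) at 1; unfold plus, scal; simpl; unfold mult; simpl; ring.
    - rewrite <- (plus_zero_l (RInt _ _ _)).
      apply (is_RInt_plus (V := R_NormedModule));
        [|apply (RInt_correct (V := R_CompleteNormedModule)), Eg].
      assert (Hn := pos_INR n).
      evar_last; [apply (is_RInt_scal (V := R_NormedModule)), is_RInt_cos; lra|].
      rewrite <- S_INR, sin_INR_PI; unfold scal, zero; simpl; unfold mult; simpl.
      unfold Rdiv; ring. }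
  change (is_lim_seq
    (sum_n (fun n => RInt (fun x => x * h x * cos ((INR n + 1) * x)) 0 PI)) (- X / 2)).
  (* Replacing the factor [x] by q(x) 2 sin (x/2) lets the kernel identity apply. Its term -sin
     (x/2) turns back into -x h(x) / 2 and integrates to -X / 2; the rest is oscillatory and tends
     to 0. *)
  apply (is_lim_seq_ext (fun N =>
    RInt (fun x => h x * q x * sin ((INR N + 3 / 2) * x)) 0 PI - X / 2)).
  { intros N; rewrite <- (is_RInt_unique _ _ _ _ (sum_n_RInt _ 0 PI N Eg)).
    symmetry; apply is_RInt_unique.
    apply (is_RInt_ext (fun x =>
      minus (h x * q x * sin ((INR N + 3 / 2) * x)) (scal (/ 2) (x * h x)))).
    - rewrite Rmin_left, Rmax_right by lra; intros x Hx.
      unfold minus, plus, opp, scal; simpl; unfold mult; simpl.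
      assert (HD := dirichlet_kernel N x).
      set (D := sum_n (fun n => cos ((INR n + 1) * x)) N) in *.
      replace (sum_n (fun n => x * h x * cos ((INR n + 1) * x)) N) with (x * h x * D)
        by exact (eq_sym (sum_n_mult_l (K := R_Ring) _ _ _)).
      assert (Hqx : q x * (2 * sin (x / 2)) = x) by (apply Hq; lra).
      replace (sin ((INR N + 3 / 2) * x)) with (2 * sin (x / 2) * D + sin (x / 2)) by lra.
      replace (h x * q x * (2 * sin (x / 2) * D + sin (x / 2)))
        with (h x * (q x * (2 * sin (x / 2))) * (D + / 2)) by field.
      rewrite Hqx; field.
    - replace (X / 2) with (scal (/ 2) X)
        by (unfold scal; simpl; unfold mult; simpl; field).
      apply (is_RInt_minus (V := R_NormedModule));
        [|apply (is_RInt_scal (V := R_NormedModule)), Ixh].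
      apply (RInt_correct (V := R_CompleteNormedModule)),
        (@ex_RInt_continuous R_CompleteNormedModule).
      rewrite Rmin_left, Rmax_right by lra; intros x Hx.
      apply continuous_Rmult; [apply continuous_Rmult; [apply Ch0|]|].
      + exact (is_derive_continuous _ _ _ (Dq x Hx)).
      + apply (@ex_derive_continuous R_AbsRing); auto_derive; trivial. }
  replace (Finite (- X / 2)) with (Finite (0 - X / 2)) by (f_equal; field).
  apply is_lim_seq_minus'; [|apply is_lim_seq_const].
  apply (riemann_lebesgue_sin (fun x => h x * q x) (fun x => h' x * q x + h x * q' x));
    [lra| |].
  - intros x Hx; apply (is_derive_mult h q); auto; intros; apply Rmult_comm.
  - intros x Hx; apply (@continuous_plus R_UniformSpace R_AbsRing R_NormedModule);
      apply continuous_Rmult; auto.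
    exact (is_derive_continuous _ _ _ (Dq x Hx)).
Qed.

(** The difference quotient at 0 is a polynomial, built without division: passing from [m] to [S m]
    replaces [h] by e c^m + (c + e x) h(x). *)
Lemma affine_pow_split (c e : R) (m : nat) :
  exists h h' : R -> R,
    (forall x, is_derive h x (h' x)) /\ (forall x, continuous h' x) /\
    (forall x, (c + e * x) ^ m = c ^ m + x * h x).
Proof.
  induction m as [|m (h & h' & Dh & Ch & Hh)].
  - exists (fun _ => 0), (fun _ => 0); split; [|split]; intros x.
    + apply (@is_derive_const R_AbsRing).
    + apply continuous_const.
    + simpl; ring.
  - assert (Dl : forall x, is_derive (fun y => c + e * y) x e).
    { intros x; auto_derive; [trivial|ring]. }
    exists (fun x => e * c ^ m + (c + e * x) * h x),
      (fun x => e * h x + (c + e * x) * h' x).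
    split; [|split]; intros x.
    + rewrite <- (Rplus_0_l (e * h x + (c + e * x) * h' x)).
      apply (@is_derive_plus R_AbsRing R_NormedModule);
        [apply (@is_derive_const R_AbsRing)|].
      apply (is_derive_mult (fun y => c + e * y) h); auto; intros; apply Rmult_comm.
    + apply (@continuous_plus R_UniformSpace R_AbsRing R_NormedModule);
        apply continuous_Rmult; auto.
      * apply continuous_const.
      * exact (is_derive_continuous _ _ _ (Dh x)).
      * exact (is_derive_continuous _ _ _ (Dl x)).
    + simpl; rewrite Hh; ring.
Qed.

(** The affine form covers the three bases used below: PI - x, 2 PI - x, and [x] itself. *)
Lemma cosine_series_affine_pow (k c e : R) (m : nat) :
  is_series (fun n => RInt (fun x => k * (c + e * x) ^ m * cos ((INR n + 1) * x)) 0 PI)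
    (PI / 2 * (k * c ^ m) - RInt (fun x => k * (c + e * x) ^ m) 0 PI / 2).
Proof.
  destruct (affine_pow_split c e m) as (h & h' & Dh & Ch & Hh).
  replace (k * c ^ m) with (k * (c + e * 0) ^ m)
    by (rewrite Rmult_0_r, Rplus_0_r; reflexivity).
  apply (cosine_series_at_0 (fun x => k * (c + e * x) ^ m)
    (fun x => k * h x) (fun x => k * h' x)).
  - intros x; apply (is_derive_scal h), Dh.
  - intros x; apply continuous_Rmult; [apply continuous_const|apply Ch].
  - intros x; rewrite (Hh x), (Hh 0); ring.
Qed.

(** * Cosine moments of divided powers: recurrence and sums *)

(** Dividing by m! makes differentiation lower the exponent without leaving a numerical factor,
    which keeps the recurrence free of coefficients. *)
Definition moment (m : nat) (L a : R) : R :=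
  RInt (fun x => (L - x) ^ m / INR (fact m) * cos (a * x)) 0 L.

Lemma continuous_moment_integrand (m : nat) (L a x : R) :
  continuous (fun y => (L - y) ^ m / INR (fact m) * cos (a * y)) x.
Proof. apply (@ex_derive_continuous R_AbsRing); auto_derive; trivial. Qed.

Lemma is_derive_divided_pow (m : nat) (L x : R) :
  is_derive (fun y => (L - y) ^ S m / INR (fact (S m))) x (- ((L - x) ^ m / INR (fact m))).
Proof.
  rewrite fact_simpl, mult_INR.
  assert (Hf := INR_fact_neq_0 m); assert (Hm : INR (S m) <> 0) by (apply not_0_INR; lia).
  revert Hf Hm; generalize (INR (fact m)); intros f Hf Hm.
  auto_derive; [trivial|].
  (* This folds back [INR (S m)], which appears here in unfolded form. *)
  change (match m with 0%nat => 1 | S _ => INR m + 1 end) with (INR (S m)).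
  cbn [Init.Nat.pred]; unfold Rminus; field; split; assumption.
Qed.

Lemma is_RInt_divided_pow (m : nat) (L b : R) :
  is_RInt (fun x => (L - x) ^ m / INR (fact m)) 0 b
    ((L ^ S m - (L - b) ^ S m) / INR (fact (S m))).
Proof.
  evar_last.
  - apply (is_RInt_derive (V := R_CompleteNormedModule)
      (fun x => - ((L - x) ^ S m / INR (fact (S m))))).
    + intros x _; evar_last.
      * apply (@is_derive_opp R_AbsRing R_NormedModule), is_derive_divided_pow.
      * unfold opp; simpl; ring.
    + intros x _; apply (@ex_derive_continuous R_AbsRing); auto_derive; trivial.
  - unfold minus, plus, opp; cbn -[pow fact]; rewrite Rminus_0_r; field.
    apply INR_fact_neq_0.
Qed.

(** Two integrations by parts done at once. With p_k = (L - x)^k / k!, the function p_(m+2) sin (a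
    x) / a - p_(m+1) cos (a x) / a^2 has derivative (p_(m+2) + p_m / a^2) cos (a x). It vanishes at
    [L], and at 0 only the cosine term survives. *)
Lemma moment_SS (m : nat) (L a : R) :
  a <> 0 ->
  moment (S (S m)) L a = (L ^ S m / INR (fact (S m)) - moment m L a) / a ^ 2.
Proof.
  intros Ha.
  pose (p k x := (L - x) ^ k / INR (fact k)).
  assert (HI : is_RInt (fun x => plus (p (S (S m)) x * cos (a * x))
      (scal (/ a ^ 2) (p m x * cos (a * x)))) 0 L (p (S m) 0 / a ^ 2)).
  { apply (is_RInt_ext (fun x =>
      (- p (S m) x * (sin (a * x) / a) + p (S (S m)) x * cos (a * x))
      - (- p m x * (cos (a * x) / a ^ 2) + p (S m) x * (- sin (a * x) / a)))).
    - intros x _; unfold plus, scal; simpl; unfold mult; simpl; field; exact Ha.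
    - evar_last.
      + apply (is_RInt_derive (V := R_CompleteNormedModule)
          (fun x => p (S (S m)) x * (sin (a * x) / a) - p (S m) x * (cos (a * x) / a ^ 2))).
        * intros x _; apply (@is_derive_minus R_AbsRing R_NormedModule);
            [apply (is_derive_mult (p (S (S m))) (fun y => sin (a * y) / a))
            |apply (is_derive_mult (p (S m)) (fun y => cos (a * y) / a ^ 2))];
            try apply is_derive_divided_pow; try (intros; apply Rmult_comm);
            auto_derive; trivial; field; exact Ha.
        * intros x _; unfold p; apply (@ex_derive_continuous R_AbsRing).
          auto_derive; trivial.
      + unfold minus, plus, opp, p; cbn -[pow fact].
        rewrite Rmult_0_r, sin_0, cos_0, !Rminus_diag, !pow_i by lia.
        field; repeat split; auto using INR_fact_neq_0. }
  (* The same integral by linearity; equating the two values gives the recurrence. *)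
  assert (HJ : is_RInt (fun x => plus (p (S (S m)) x * cos (a * x))
      (scal (/ a ^ 2) (p m x * cos (a * x)))) 0 L
      (moment (S (S m)) L a + / a ^ 2 * moment m L a)).
  { apply (is_RInt_plus (V := R_NormedModule));
      [|apply (is_RInt_scal (V := R_NormedModule))];
      apply (RInt_correct (V := R_CompleteNormedModule)), ex_RInt_continuous_R;
      intros x; apply continuous_moment_integrand. }
  apply (is_RInt_unique (V := R_CompleteNormedModule)) in HI, HJ; rewrite HJ in HI.
  unfold p in HI; rewrite Rminus_0_r in HI.
  unfold Rdiv; rewrite Rmult_minus_distr_r.
  apply (f_equal (fun t => t - / a ^ 2 * moment m L a)) in HI.
  unfold Rdiv in HI; lra.
Qed.

Lemma moment_0 (L a : R) : a <> 0 -> moment 0 L a = sin (a * L) / a.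
Proof.
  intros Ha; apply is_RInt_unique, (is_RInt_ext (fun x => cos (a * x))).
  - intros x _; simpl; field.
  - apply is_RInt_cos, Ha.
Qed.

Lemma moment_1 (L a : R) : a <> 0 -> moment 1 L a = (1 - cos (a * L)) / a ^ 2.
Proof.
  intros Ha; apply is_RInt_unique; evar_last.
  - apply (is_RInt_derive (V := R_CompleteNormedModule)
      (fun x => (L - x) * (sin (a * x) / a) - cos (a * x) / a ^ 2)).
    + intros x _; auto_derive; [trivial|simpl; field; exact Ha].
    + intros x _; apply continuous_moment_integrand.
  - unfold minus, plus, opp; simpl; rewrite Rmult_0_r, sin_0, cos_0; field; exact Ha.
Qed.

Lemma moment_series_PI (m : nat) :
  is_series (fun n => moment m PI (INR n + 1))
    (PI / 2 * (PI ^ m / INR (fact m)) - PI ^ S m / INR (fact (S m)) / 2).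
Proof.
  generalize (cosine_series_affine_pow (/ INR (fact m)) PI (-1) m); intros H.
  assert (E : forall x, / INR (fact m) * (PI + -1 * x) ^ m = (PI - x) ^ m / INR (fact m)).
  { intros x; replace (PI + -1 * x) with (PI - x) by ring; apply Rmult_comm. }
  rewrite (RInt_ext _ (fun x => (PI - x) ^ m / INR (fact m))) in H by (intros x _; apply E).
  rewrite (is_RInt_unique _ _ _ _ (is_RInt_divided_pow m PI PI)) in H.
  rewrite Rminus_diag, pow_i, Rminus_0_r, (Rmult_comm (/ INR (fact m))) in H by lia.
  revert H; apply is_series_ext; intros n.
  apply RInt_ext; intros x _; cbv beta; rewrite E; reflexivity.
Qed.

(* The part of the moment over [PI, 2 PI] is reflected to [0, PI], where it is
   the moment of a power vanishing at 0. *)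
Lemma moment_series_2PI (m : nat) :
  (1 <= m)%nat ->
  is_series (fun n => moment m (2 * PI) (INR n + 1))
    (PI / 2 * ((2 * PI) ^ m / INR (fact m)) - (2 * PI) ^ S m / INR (fact (S m)) / 2).
Proof.
  intros Hm; set (k := / INR (fact m)).
  set (f1 := fun n x => k * (2 * PI + -1 * x) ^ m * cos ((INR n + 1) * x)).
  set (f2 := fun n x => k * (0 + 1 * x) ^ m * cos ((INR n + 1) * x)).
  assert (C : forall c e n, ex_RInt (fun x => k * (c + e * x) ^ m * cos ((INR n + 1) * x)) 0 PI).
  { intros c e n; apply ex_RInt_continuous_R; intros x.
    apply (@ex_derive_continuous R_AbsRing); auto_derive; trivial. }
  assert (E : forall n, plus (RInt (f1 n) 0 PI) (RInt (f2 n) 0 PI) = moment m (2 * PI) (INR n + 1)).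
  { intros n; symmetry; apply is_RInt_unique, (is_RInt_ext (f1 n)).
    - intros x _; unfold f1, k.
      replace (2 * PI + -1 * x) with (2 * PI - x) by ring.
      rewrite (Rmult_comm (/ _)); reflexivity.
    - apply (is_RInt_Chasles (V := R_NormedModule)) with PI;
        [apply (RInt_correct (V := R_CompleteNormedModule)), C|].
      rewrite <- (opp_opp (RInt (f2 n) 0 PI)).
      apply (is_RInt_swap (V := R_NormedModule)).
      (* Substitution of 2 PI - x for x: it fixes cos ((n + 1) x) and reverses orientation, hence
         the preceding swap of bounds and the two signs. *)
      apply (is_RInt_ext (fun x => opp (scal (-1) (f2 n (-1 * x + 2 * PI))))).
      + intros x _; unfold f1, f2, opp, scal; simpl; unfold mult; simpl.
        replace (0 + 1 * (-1 * x + 2 * PI)) with (2 * PI + -1 * x) by ring.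
        replace (cos ((INR n + 1) * (-1 * x + 2 * PI))) with (cos ((INR n + 1) * x)).
        * ring.
        * rewrite <- cos_neg, <- (cos_period _ (S n)), S_INR; f_equal; ring.
      + apply (is_RInt_opp (V := R_NormedModule)), (is_RInt_comp_lin (V := R_NormedModule)).
        replace (-1 * (2 * PI) + 2 * PI) with 0 by ring.
        replace (-1 * PI + 2 * PI) with PI by ring.
        apply (RInt_correct (V := R_CompleteNormedModule)), C. }
  apply (is_series_ext _ _ _ E).
  assert (H := is_series_plus (K := R_AbsRing) (V := R_NormedModule) _ _ _ _
    (cosine_series_affine_pow k (2 * PI) (-1) m) (cosine_series_affine_pow k 0 1 m)).
  assert (I1 : RInt (fun x => k * (2 * PI + -1 * x) ^ m) 0 PI =
      ((2 * PI) ^ S m - PI ^ S m) / INR (fact (S m))).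
  { rewrite (RInt_ext _ (fun x => (2 * PI - x) ^ m / INR (fact m))).
    - rewrite (is_RInt_unique _ _ _ _ (is_RInt_divided_pow m (2 * PI) PI)).
      do 3 f_equal; ring.
    - intros x _; unfold k; replace (2 * PI + -1 * x) with (2 * PI - x) by ring.
      apply Rmult_comm. }
  assert (Hsgn : (-1) ^ m * (-1) ^ m = 1).
  { rewrite <- Rpow_mult_distr; replace (-1 * -1) with 1 by ring; apply pow1. }
  (* Writing x^m as (-1)^m (0 - x)^m brings it under the divided-power integral with [L] = 0. *)
  assert (Hrev : forall x, k * (0 + 1 * x) ^ m = (-1) ^ m * ((0 - x) ^ m / INR (fact m))).
  { intros x; replace (0 + 1 * x) with ((-1) * (0 - x)) by ring.
    rewrite Rpow_mult_distr; unfold k, Rdiv; ring. }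
  assert (I2 : RInt (fun x => k * (0 + 1 * x) ^ m) 0 PI = PI ^ S m / INR (fact (S m))).
  { rewrite (RInt_ext _ (fun x => (-1) ^ m * ((0 - x) ^ m / INR (fact m)))).
    - apply is_RInt_unique; evar_last.
      + apply (is_RInt_scal (V := R_NormedModule)), is_RInt_divided_pow.
      + change ((-1) ^ m * ((0 ^ S m - (0 - PI) ^ S m) / INR (fact (S m))) =
          PI ^ S m / INR (fact (S m))).
        replace (0 - PI) with ((-1) * PI) by ring.
        rewrite pow_i, Rpow_mult_distr, <- (tech_pow_Rmult (-1)) by lia.
        transitivity ((-1) ^ m * (-1) ^ m * PI ^ S m / INR (fact (S m))).
        * field; apply INR_fact_neq_0.
        * rewrite Hsgn, Rmult_1_l; reflexivity.
    - intros x _; apply Hrev. }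
  rewrite I1, I2, pow_i in H by lia.
  (* The two contributions in PI^(m+1), one from each half of [0, 2 PI], cancel. *)
  replace (PI / 2 * ((2 * PI) ^ m / INR (fact m)) - (2 * PI) ^ S m / INR (fact (S m)) / 2)
    with (PI / 2 * (k * (2 * PI) ^ m) - ((2 * PI) ^ S m - PI ^ S m) / INR (fact (S m)) / 2
      + (PI / 2 * (k * 0) - PI ^ S m / INR (fact (S m)) / 2)).
  - exact H.
  - unfold k; field; split; apply INR_fact_neq_0.
Qed.

(** * Series manipulations and the solved recurrence *)

Lemma sum_n_m_Rmult_l (c : R) (a : nat -> R) (p q : nat) :
  sum_n_m (fun k => c * a k) p q = c * sum_n_m a p q.
Proof. exact (sum_n_m_mult_l (K := R_Ring) c a p q). Qed.

Lemma is_series_sum_n_m (a : nat -> nat -> R) (l : nat -> R) (p q : nat) :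
  (forall k, (p <= k <= q)%nat -> is_series (a k) (l k)) ->
  is_series (fun n => sum_n_m (fun k => a k n) p q) (sum_n_m l p q).
Proof.
  destruct (Nat.le_gt_cases p q) as [Hpq|Hpq].
  - induction Hpq as [|q Hpq IH]; intros H.
    + rewrite sum_n_n.
      apply (is_series_ext (a p)); [intros n; rewrite sum_n_n; reflexivity|apply H; lia].
    + rewrite sum_n_Sm by lia.
      apply (is_series_ext (fun n => plus (sum_n_m (fun k => a k n) p q) (a (S q) n))).
      * intros n; rewrite sum_n_Sm by lia; reflexivity.
      * apply (is_series_plus (K := R_AbsRing) (V := R_NormedModule));
          [apply IH; intros; apply H; lia|apply H; lia].
  (* The empty range, which occurs in the final formulas for s = 1, gives the zero series. *)
  - intros _; rewrite sum_n_m_zero by lia.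
    apply (is_series_ext (fun _ => 0)).
    + intros n; rewrite sum_n_m_zero by lia; reflexivity.
    + apply filterlim_ext with (fun _ => 0); [|apply filterlim_const].
      intros n; rewrite sum_n_const; symmetry; apply Rmult_0_r.
Qed.

(** The partial sum of the even-indexed terms up to [N] is the full partial sum up to 2N, so it runs
    along a subsequence of a convergent sequence. *)
Lemma is_series_even_terms (b : nat -> R) (l : R) :
  (forall n, b (S (2 * n)) = 0) -> is_series b l -> is_series (fun n => b (2 * n)%nat) l.
Proof.
  intros Hb H.
  change (is_lim_seq (sum_n (fun n => b (2 * n)%nat)) l).
  apply (is_lim_seq_ext (fun N => sum_n b (2 * N))).
  - induction n as [|n IH]; [rewrite !sum_O; reflexivity|].
    replace (2 * S n)%nat with (S (S (2 * n))) by lia.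
    rewrite !sum_Sn, Hb, IH; replace (2 * S n)%nat with (S (S (2 * n))) by lia.
    unfold plus; simpl; ring.
  - apply (is_lim_seq_subseq (sum_n b) l (fun N => (2 * N)%nat)); [|exact H].
    apply eventually_subseq; intros; lia.
Qed.

(** The homogeneous solution of the recurrence is (-1)^(s-1) e / q^s. Isolating it expresses the
    term to be summed through the moment [u s] and lower powers of 1 / q. *)
Lemma unroll_recurrence (u d : nat -> R) (e q : R) :
  q <> 0 -> u 1%nat = e / q ->
  (forall s, (1 <= s)%nat -> u (S s) = (d s - u s) / q) ->
  forall s, (1 <= s)%nat ->
  e / q ^ s =
    (-1) ^ (s - 1) * (u s + sum_n_m (fun k => (-1) ^ (s - k) * d k * / q ^ (s - k)) 1 (s - 1)).
Proof.
  intros Hq H1 HS [|t] Hs; [lia|clear Hs].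
  replace (S t - 1)%nat with t by lia.
  induction t as [|t IH].
  - rewrite sum_n_m_zero by lia; rewrite H1; unfold zero; simpl; field; exact Hq.
  - rewrite sum_n_Sm by lia.
    (* Raising the order multiplies each old summand by -1 / q. The new top summand cancels the [d]
       term of the recurrence, leaving -1 / q times the previous bracket. *)
    rewrite (sum_n_m_ext_loc _ (fun k => - / q *
      ((-1) ^ (S t - k) * d k * / q ^ (S t - k)))).
    + rewrite sum_n_m_Rmult_l, HS by lia.
      replace (S (S t) - S t)%nat with 1%nat by lia.
      unfold plus; cbn -[pow sum_n_m].
      replace (e / q ^ S (S t)) with (e / q ^ S t / q)
        by (simpl; field; split; [apply pow_nonzero, Hq|exact Hq]).
      rewrite IH; simpl; field; exact Hq.
    + intros k Hk; replace (S (S t) - k)%nat with (S (S t - k)) by lia.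
      simpl; field; split; [apply pow_nonzero, Hq|exact Hq].
Qed.

(** * Even zeta values, and the reduction of theta and phi *)

Lemma Rpower_opp_even (a : R) (j : nat) :
  0 < a -> Rpower a (- (2 * INR j)) = / (a ^ 2) ^ j.
Proof.
  intros Ha; rewrite Rpower_Ropp; replace (2 * INR j) with (INR (2 * j)).
  - rewrite Rpower_pow, pow_mult by exact Ha; reflexivity.
  - rewrite mult_INR; reflexivity.
Qed.

Lemma sin_even_multiple (n : nat) : sin ((INR n + 1) * (2 * PI)) = 0.
Proof.
  replace ((INR n + 1) * (2 * PI)) with (0 + 2 * INR (S n) * PI) by (rewrite S_INR; ring).
  rewrite sin_period; apply sin_0.
Qed.

(** Over a whole number of periods the moment of order 0 vanishes. The result starts the even
    recurrence and also serves as a summable majorant for the zeta series. *)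
Lemma moment_2_2PI (n : nat) :
  moment 2 (2 * PI) (INR n + 1) = 2 * PI / (INR n + 1) ^ 2.
Proof.
  assert (Hn := pos_INR n).
  rewrite moment_SS, moment_0, sin_even_multiple by lra; simpl; field; lra.
Qed.

(** Convergence comes from the moments themselves: those of order 2 on [0, 2 PI] are 2 PI / a^2 and
    have a convergent sum, and 1 / a^(2j) is at most 1 / a^2 for a >= 1. *)
Lemma is_series_zeta_even (j : nat) :
  (1 <= j)%nat -> is_series (fun n => / ((INR n + 1) ^ 2) ^ j) (zeta (2 * INR j)).
Proof.
  intros Hj; assert (P0 := PI_RGT_0).
  assert (E : forall n, Rpower (INR (n + 1)) (- (2 * INR j)) = / ((INR n + 1) ^ 2) ^ j).
  { intros n; assert (Hn := pos_INR n); rewrite plus_INR; apply Rpower_opp_even; simpl; lra. }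
  apply (is_series_ext _ _ _ E), Series_correct.
  apply (ex_series_le (K := R_AbsRing) (V := R_CompleteNormedModule) _
    (fun n => moment 2 (2 * PI) (INR n + 1) * / (2 * PI))).
  - intros n; assert (Hn := pos_INR n); rewrite E, moment_2_2PI.
    replace (2 * PI / (INR n + 1) ^ 2 * / (2 * PI)) with (/ ((INR n + 1) ^ 2) ^ 1)
      by (field; lra).
    assert (H1 : 1 <= (INR n + 1) ^ 2) by nra.
    unfold norm; simpl norm; rewrite Rabs_pos_eq.
    + apply Rinv_le_contravar; [apply pow_lt; lra|apply Rle_pow; auto].
    + left; apply Rinv_0_lt_compat, pow_lt; lra.
  - eexists; apply is_series_scal_r, moment_series_2PI; lia.
Qed.

(** The solved recurrence with q = (n + 1)^2 is summed over [n]. The finite sum is exchanged with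
    the series, and each power 1 / q^(s-k) sums to a zeta value; since k <= s - 1, its exponent is
    at least 2. *)
Lemma is_series_unrolled (u : nat -> nat -> R) (d e : nat -> R) (s : nat) (U : R) :
  (1 <= s)%nat ->
  (forall n, u 1%nat n = e n / (INR n + 1) ^ 2) ->
  (forall t n, (1 <= t)%nat -> u (S t) n = (d t - u t n) / (INR n + 1) ^ 2) ->
  is_series (u s) U ->
  is_series (fun n => e n / ((INR n + 1) ^ 2) ^ s)
    ((-1) ^ (s - 1) *
     (U + sum_n_m (fun k => (-1) ^ (s - k) * d k * zeta (2 * INR s - 2 * INR k)) 1 (s - 1))).
Proof.
  intros Hs H1 HS HU.
  apply (is_series_ext (fun n => (-1) ^ (s - 1) * (u s n +
    sum_n_m (fun k => (-1) ^ (s - k) * d k * / ((INR n + 1) ^ 2) ^ (s - k)) 1 (s - 1)))).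
  - intros n; symmetry; assert (Hn := pos_INR n).
    apply (unroll_recurrence (fun t => u t n) d); auto; apply pow_nonzero; lra.
  - apply (is_series_scal (K := R_AbsRing) (V := R_NormedModule)),
      (is_series_plus (K := R_AbsRing) (V := R_NormedModule)); [exact HU|].
    apply is_series_sum_n_m; intros k Hk.
    apply (is_series_scal (K := R_AbsRing) (V := R_NormedModule)).
    rewrite <- Rmult_minus_distr_l, <- minus_INR by lia.
    apply is_series_zeta_even; lia.
Qed.

(** The numerator is 2 for odd a = n + 1 and 0 for even a. Because of the shift, odd a are the even
    indices [n]. *)
Lemma theta_even_from_moments (s : nat) (V : R) :
  is_series (fun n => (1 - cos ((INR n + 1) * PI)) / ((INR n + 1) ^ 2) ^ s) V ->
  theta (2 * INR s) = V / 2.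
Proof.
  intros H; apply is_series_even_terms in H.
  - apply is_series_unique.
    apply (is_series_ext (fun n => (1 - cos ((INR (2 * n) + 1) * PI)) /
      ((INR (2 * n) + 1) ^ 2) ^ s * / 2)); [|apply is_series_scal_r, H].
    intros n; assert (Hn := pos_INR (2 * n)).
    rewrite plus_INR; change (INR 1) with 1; rewrite Rpower_opp_even by lra.
    replace ((INR (2 * n) + 1) * PI) with (PI + 2 * INR n * PI)
      by (rewrite mult_INR; simpl; ring).
    rewrite cos_period, cos_PI; unfold Rdiv.
    replace (1 - -1) with 2 by ring.
    rewrite (Rmult_comm 2), Rmult_assoc, Rinv_r, Rmult_1_r by lra; reflexivity.
  - intros n; replace ((INR (S (2 * n)) + 1) * PI) with (0 + 2 * INR (S n) * PI)
      by (rewrite !S_INR, mult_INR; simpl; ring).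
    rewrite cos_period, cos_0; unfold Rdiv; ring.
Qed.

Lemma phi_zeta_even (s : nat) :
  phi (2 * INR s) = / 2 ^ (2 * s) * zeta (2 * INR s).
Proof.
  unfold phi, zeta; rewrite <- Series_scal_l; apply Series_ext; intros n.
  assert (Hn : 0 < INR (n + 1)) by (apply lt_0_INR; lia).
  rewrite mult_INR; change (INR 2) with 2.
  rewrite !Rpower_opp_even, !pow_mult, !Rpow_mult_distr by lra.
  apply Rinv_mult.
Qed.

(** * Odd moments on [0, PI] for theta, even moments on [0, 2 PI] for phi *)

Theorem theorem1p2 (s : nat) (hs : (1 <= s)%nat) :
  theta (2 * INR s) =
    (-1) ^ (s - 1) *
    ((2 * INR s - 1) * PI ^ (2 * s) / (4 * INR (fact (2 * s))) +
     sum_n_m (fun k : nat =>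
        (-1) ^ (s - k) * PI ^ (2 * k) / (2 * INR (fact (2 * k))) *
        zeta (2 * INR s - 2 * INR k)) 1 (s - 1))
  /\
  phi (2 * INR s) =
    (-1) ^ (s - 1) *
    ((2 * INR s - 1) * PI ^ (2 * s) / (4 * INR (fact (2 * s + 1))) +
     sum_n_m (fun k : nat =>
        (-1) ^ (s - k) * PI ^ (2 * k) /
          (INR (fact (2 * k + 1)) * 2 ^ (2 * s - 2 * k)) *
        zeta (2 * INR s - 2 * INR k)) 1 (s - 1)).
Proof.
  assert (P0 := PI_RGT_0); split.
  - assert (H : is_series (fun n => (1 - cos ((INR n + 1) * PI)) / ((INR n + 1) ^ 2) ^ s)
      ((-1) ^ (s - 1) * ((PI / 2 * (PI ^ (2 * s - 1) / INR (fact (2 * s - 1)))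
          - PI ^ S (2 * s - 1) / INR (fact (S (2 * s - 1))) / 2) +
        sum_n_m (fun k => (-1) ^ (s - k) * (PI ^ (2 * k) / INR (fact (2 * k))) *
          zeta (2 * INR s - 2 * INR k)) 1 (s - 1)))).
    { apply (is_series_unrolled (fun t n => moment (2 * t - 1) PI (INR n + 1))
        (fun k => PI ^ (2 * k) / INR (fact (2 * k)))); [exact hs| | |apply moment_series_PI].
      - intros n; assert (Hn := pos_INR n); apply moment_1; lra.
      - intros t n Ht; assert (Hn := pos_INR n).
        replace (2 * S t - 1)%nat with (S (S (2 * t - 1))) by lia.
        rewrite moment_SS by lra; replace (S (2 * t - 1)) with (2 * t)%nat by lia.
        reflexivity. }
    rewrite (theta_even_from_moments s _ H); clear H.
    replace (S (2 * s - 1)) with (2 * s)%nat by lia.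
    unfold Rdiv at 1; rewrite Rmult_assoc; f_equal.
    rewrite Rmult_plus_distr_r; f_equal.
    (* With (2s)! = 2s (2s-1)!, the moment sum is (2s - 1) PI^(2s) / (2 (2s)!); halving it produces
       the 4. *)
    + assert (Hs : INR s <> 0) by (apply not_0_INR; lia).
      assert (HP : PI ^ (2 * s) = PI * PI ^ (2 * s - 1)).
      { rewrite tech_pow_Rmult; f_equal; lia. }
      assert (Hf : INR (fact (2 * s)) = 2 * INR s * INR (fact (2 * s - 1))).
      { change 2 with (INR 2); rewrite <- !mult_INR; f_equal.
        replace (2 * s)%nat with (S (2 * s - 1)) at 1 2 by lia; apply fact_simpl. }
      rewrite HP, Hf; field; split; [apply INR_fact_neq_0|exact Hs].
    + rewrite Rmult_comm.
      rewrite <- sum_n_m_Rmult_l.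
      apply sum_n_m_ext; intros k; cbn -[pow fact Nat.mul].
      field; apply INR_fact_neq_0.
  - assert (H : is_series (fun n => 2 * PI / ((INR n + 1) ^ 2) ^ s)
      ((-1) ^ (s - 1) * ((PI / 2 * ((2 * PI) ^ (2 * s) / INR (fact (2 * s)))
          - (2 * PI) ^ S (2 * s) / INR (fact (S (2 * s))) / 2) +
        sum_n_m (fun k => (-1) ^ (s - k) * ((2 * PI) ^ S (2 * k) / INR (fact (S (2 * k)))) *
          zeta (2 * INR s - 2 * INR k)) 1 (s - 1)))).
    { apply (is_series_unrolled (fun t n => moment (2 * t) (2 * PI) (INR n + 1))
        (fun k => (2 * PI) ^ S (2 * k) / INR (fact (S (2 * k)))));
        [exact hs|apply moment_2_2PI| |apply moment_series_2PI; lia].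
      intros t n Ht; assert (Hn := pos_INR n).
      replace (2 * S t)%nat with (S (S (2 * t))) by lia.
      apply moment_SS; lra. }
    (* The numerator is now constant, so the series just evaluated also sums to 2 PI zeta(2s);
       uniqueness of the sum gives the equation for zeta. *)
    assert (Hz : is_series (fun n => 2 * PI / ((INR n + 1) ^ 2) ^ s) (2 * PI * zeta (2 * INR s))).
    { apply (is_series_scal (K := R_AbsRing) (V := R_NormedModule) (2 * PI)).
      apply is_series_zeta_even, hs. }
    apply is_series_unique in H, Hz; rewrite Hz in H; clear Hz.
    assert (H2 : (2 : R) ^ (2 * s) <> 0) by (apply pow_nonzero; lra).
    rewrite phi_zeta_even; apply (Rmult_eq_reg_l (2 * PI * 2 ^ (2 * s)));
      [|apply Rmult_integral_contrapositive_currified; [lra|exact H2]].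
    replace (2 * PI * 2 ^ (2 * s) * (/ 2 ^ (2 * s) * zeta (2 * INR s)))
      with (2 * PI * zeta (2 * INR s)) by (field; exact H2).
    rewrite H, <- Rmult_assoc, (Rmult_comm _ ((-1) ^ (s - 1))), Rmult_assoc; clear H.
    f_equal; rewrite Rmult_plus_distr_l.
    replace (2 * s + 1)%nat with (S (2 * s)) by lia.
    f_equal.
    + rewrite <- (tech_pow_Rmult (2 * PI)), Rpow_mult_distr, fact_simpl, mult_INR, S_INR, mult_INR.
      change (INR 2) with 2; assert (Hs := pos_INR s).
      field; repeat split; try apply INR_fact_neq_0; try lra; exact H2.
    + rewrite <- sum_n_m_Rmult_l.
      apply sum_n_m_ext_loc; intros k Hk; cbn -[pow fact Nat.mul Nat.sub].
      replace (2 * k + 1)%nat with (S (2 * k)) by lia.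
      (* Splitting the exponent lets 2^(2k) join PI^(2k), while the remaining 2^(2s-2k) cancels the
         denominator. *)
      replace (2 * s)%nat with (2 * k + (2 * s - 2 * k))%nat by lia.
      rewrite pow_add, <- (tech_pow_Rmult (2 * PI)), Rpow_mult_distr.
      replace (2 * k + (2 * s - 2 * k) - 2 * k)%nat with (2 * s - 2 * k)%nat by lia.
      field; repeat split; try apply INR_fact_neq_0; try (apply pow_nonzero; lra).
Qed.
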